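(* Let $a$ be an orthodox set of £. Then there is an infinite sequence of terms $b_1,b_2,b_3,\dots$ such that each $b_n$ is orthodox, $\Vdash^M b_i\neq b_j$ whenever $i\neq j$, and $\Vdash^M\forall x(x\in b_n\leftrightarrow x\in a)$ for every $n$.
   Context: The language of the librationist theory £: variables; primitive set constants $\mathcal T$ (truth set) and $\mathcal F$; atomic formulas $a\in b$; formulas $\downarrow AB$ (joint denial), $\forall vA$; terms $\{v\mid A\}$; name terms $\ulcorner X\urcorner$. $\neg A:=\downarrow AA$, other connectives and $\exists$ classical; $\mathcal TA$ abbreviates $\ulcorner A\urcorner\in\mathcal T$. Identity: $a=b:\equiv\forall u(a\in u\to b\in u)$, $a\neq b:\equiv\neg a=b$. Semantics: for each $n\in\omega$ and ordinal $\alpha$ a full set $\models^\alpha_n$ of formulas ($\downarrow AB$ in it iff neither $A$ nor $B$; $\forall vA$ in it iff all substitution instances $A^b_v$ are); $(\models^0_n)_n$ a fixed enumeration of full sets; for $\alpha>0$, $\mathcal TA\in\models^\alpha_n$ iff for some $\gamma<\alpha$, $A\in\models^\delta_n$ for all $\gamma\le\delta<\alpha$, and $a\in\{x\mid A\}\in\models^\alpha_n$ iff $\mathcal TA^a_x\in\models^\alpha_n$. $\models^\alpha B$ iff $B\in\models^\alpha_n$ for all $n$. $\mathrm{IN}^\alpha(A)$ iff $\models^\beta\mathcal TA$ for all $\beta\ge\alpha$; $\mathrm{IN}(A)$ iff $\exists\alpha\,\mathrm{IN}^\alpha(A)$; $\alpha$ stabilizes $A$ iff ($\mathrm{IN}(A)\Rightarrow\mathrm{IN}^\alpha(A)$)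 and ($\models^\alpha\mathcal TA\Rightarrow\mathrm{IN}(A)$); $\varpi$ is the least ordinal stabilizing every sentence. $\Vdash^MA$ iff $\mathcal TA\in\models^\varpi_n$ for all $n$; $\Vdash^OA$ iff $A\in\models^\varpi_n$ for all $n$. A set $b$ is orthodox iff $\Vdash^O\forall x(\mathcal T(x\in b)\vee\mathcal T(x\notin b))$.
   Formalization: The formal theorem adds the assumption ϖ > 1 (equivalently ϖ ≠ 0, i.e. the starting full sets do not already stabilize every sentence); without it the claim can fail, since the truth clause does not govern stage 0. *)

(* Defs.v *)
From Stdlib Require Import Arith.

(* [osup f] is the least ordinal strictly above every [f i].  Distinct trees may
   denote the same ordinal, so equality of ordinals is [oeq]. *)
Inductive Ord : Type := osup (X : Type) (f : X -> Ord).

Fixpoint ole (a b : Ord) {struct a} : Prop :=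
  match a with
  | osup X f =>
      forall i : X, match b with osup Y g => exists j : Y, ole (f i) (g j) end
  end.

Definition olt (a b : Ord) : Prop :=
  match b with osup Y g => exists j : Y, ole a (g j) end.

Definition oeq (a b : Ord) : Prop := ole a b /\ ole b a.

Definition ozero : Ord := osup Empty_set (fun e => match e with end).
Definition osucc (a : Ord) : Ord := osup unit (fun _ => a).

(* [cT] is the truth set and [cF] the second primitive set constant; [nameT] and
   [nameF] name terms and formulas. *)
Inductive term : Type :=
| var (v : nat)
| cT
| cF
| abs (v : nat) (A : form)
| nameT (t : term)
| nameF (A : form)
with form : Type :=
| mem (a b : term)
| down (A B : form)
| all (v : nat) (A : form).

(* Names are transparent: the free variables of a name are those of the named
   expression, and substitution acts inside it.  This is what gives sense to
   quantifying into truth ascriptions, as in the definition of orthodoxy. *)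
Fixpoint free_t (x : nat) (t : term) : Prop :=
  match t with
  | var v => v = x
  | cT | cF => False
  | abs v A => v <> x /\ free_f x A
  | nameT s => free_t x s
  | nameF A => free_f x A
  end
with free_f (x : nat) (A : form) : Prop :=
  match A with
  | mem a b => free_t x a \/ free_t x b
  | down A B => free_f x A \/ free_f x B
  | all v A => v <> x /\ free_f x A
  end.

Definition closed (t : term) : Prop := forall x, ~ free_t x t.
Definition sentence (A : form) : Prop := forall x, ~ free_f x A.

(* Only used with closed [b], so no variable of [b] can be captured. *)
Fixpoint subst_t (x : nat) (b : term) (t : term) : term :=
  match t with
  | var v => if Nat.eqb v x then b else t
  | cT | cF => t
  | abs v A => if Nat.eqb v x then t else abs v (subst_f x b A)
  | nameT s => nameT (subst_t x b s)
  | nameF A => nameF (subst_f x b A)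
  end
with subst_f (x : nat) (b : term) (A : form) : form :=
  match A with
  | mem s t => mem (subst_t x b s) (subst_t x b t)
  | down A B => down (subst_f x b A) (subst_f x b B)
  | all v B => if Nat.eqb v x then A else all v (subst_f x b B)
  end.

(* A strict upper bound of the variables occurring, hence a fresh variable. *)
Fixpoint fresh_t (t : term) : nat :=
  match t with
  | var v => S v
  | cT | cF => 0
  | abs v A => Nat.max (S v) (fresh_f A)
  | nameT s => fresh_t s
  | nameF A => fresh_f A
  end
with fresh_f (A : form) : nat :=
  match A with
  | mem a b => Nat.max (fresh_t a) (fresh_t b)
  | down A B => Nat.max (fresh_f A) (fresh_f B)
  | all v A => Nat.max (S v) (fresh_f A)
  end.

Definition negF (A : form) : form := down A A.
Definition orF (A B : form) : form := negF (down A B).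
Definition andF (A B : form) : form := down (negF A) (negF B).
Definition impF (A B : form) : form := orF (negF A) B.
Definition iffF (A B : form) : form := andF (impF A B) (impF B A).

Definition Tr (A : form) : form := mem (nameF A) cT.

Definition eqF (a b : term) : form :=
  let u := Nat.max (fresh_t a) (fresh_t b) in
  all u (impF (mem a (var u)) (mem b (var u))).

Definition neqF (a b : term) : form := negF (eqF a b).

Definition coextF (a b : term) : form :=
  let x := Nat.max (fresh_t a) (fresh_t b) in
  all x (iffF (mem (var x) a) (mem (var x) b)).

Definition orthodoxF (b : term) : form :=
  let x := fresh_t b in
  all x (orF (Tr (mem (var x) b)) (Tr (negF (mem (var x) b)))).

Definition full (Xi : form -> Prop) : Prop :=
  (forall A B, sentence (down A B) ->
     (Xi (down A B) <-> ~ Xi A /\ ~ Xi B)) /\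
  (forall v A, sentence (all v A) ->
     (Xi (all v A) <-> forall b, closed b -> Xi (subst_f v b A))).

(* [sat alpha n A] is membership of [A] in the [n]-th set at stage [alpha].
   Stage zero is an arbitrary sequence of full sets; atoms not governed by the
   last two clauses (such as membership in [cF]) are unconstrained. *)
Record librationist (sat : Ord -> nat -> form -> Prop) : Prop := {
  sat_oeq : forall alpha beta n A,
    oeq alpha beta -> sat alpha n A -> sat beta n A;
  sat_full : forall alpha n, full (sat alpha n);
  sat_Tr : forall alpha n A, olt ozero alpha -> sentence A ->
    (sat alpha n (Tr A) <->
     exists gamma, olt gamma alpha /\
       forall delta, ole gamma delta -> olt delta alpha -> sat delta n A);
  sat_abs : forall alpha n a x A, olt ozero alpha ->
    closed a -> closed (abs x A) ->
    (sat alpha n (mem a (abs x A)) <-> sat alpha n (Tr (subst_f x a A)))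
}.

Section Stabilization.
Variable sat : Ord -> nat -> form -> Prop.

Definition models (alpha : Ord) (B : form) : Prop := forall n, sat alpha n B.

Definition INat (alpha : Ord) (A : form) : Prop :=
  forall beta, ole alpha beta -> models beta (Tr A).

Definition IN (A : form) : Prop := exists alpha, INat alpha A.

Definition stabilizes (alpha : Ord) (A : form) : Prop :=
  (IN A -> INat alpha A) /\ (models alpha (Tr A) -> IN A).

Definition stabilizes_all (alpha : Ord) : Prop :=
  forall A, sentence A -> stabilizes alpha A.

Definition is_varpi (varpi : Ord) : Prop :=
  stabilizes_all varpi /\ forall alpha, stabilizes_all alpha -> ole varpi alpha.

Definition forcesM (varpi : Ord) (A : form) : Prop := forall n, sat varpi n (Tr A).
Definition forcesO (varpi : Ord) (A : form) : Prop := forall n, sat varpi n A.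

Definition orthodox (varpi : Ord) (b : term) : Prop :=
  closed b /\ forcesO varpi (orthodoxF b).

End Stabilization.

(* Main.v *)
From Stdlib Require Import Arith List Classical.
Require Import Defs.

(** For a list [L] of sets already found, let [B x] be
    [{y | y in a iff x notin x}], let [r] be the set of all [x] such that [B x] is
    identical to a member of [L], and take [B r] as the next set.  Leibniz identity
    at a stage implies both identity and coextensionality at the stages just below
    it, so by well-founded descent an identity holds at all earlier stages.  If
    [B r] were identical to some [p] in [L] at a late stage, then [r in r] would
    hold all the way up to it, so [B r] would have the members of the complement
    of [a], whereas [p] has the members of [a].  Hence eventually [r notin r], so
    [B r] is coextensive with [a] and differs from every member of [L].

    To pass between "eventually" and [varpi], one shows that [varpi] is a limit and
    that [b] is orthodox exactly when each sentence [c in b <-> T (c in b)] holds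
    from some stage on; such a sentence keeps the truth value of [c in b] constant. *)

(** * Ordinals *)

Lemma ole_refl a : ole a a.
Proof. induction a as [X f IH]; simpl; intros i; exists i; apply IH. Qed.

Lemma ole_trans a b c : ole a b -> ole b c -> ole a c.
Proof.
  revert b c; induction a as [X f IH]; intros [Y g] [Z h] Hab Hbc i; simpl in *.
  destruct (Hab i) as [j Hj]; destruct (Hbc j) as [k Hk].
  exists k; exact (IH i _ _ Hj Hk).
Qed.

Lemma ole_olt_trans a b c : ole a b -> olt b c -> olt a c.
Proof. destruct c as [Z h]; intros H [k Hk]; exists k; exact (ole_trans _ _ _ H Hk). Qed.

Lemma olt_ole_trans a b c : olt a b -> ole b c -> olt a c.
Proof.
  destruct b as [Y g], c as [Z h]; intros [j Hj] H; destruct (H j) as [k Hk].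
  exists k; exact (ole_trans _ _ _ Hj Hk).
Qed.

Lemma osucc_ole_olt a b : ole (osucc a) b -> olt a b.
Proof. destruct b; intros H; exact (H tt). Qed.

Lemma olt_osucc_ole a b : olt a b -> ole (osucc a) b.
Proof. destruct b; intros H _; exact H. Qed.

Lemma ole_olt_osucc a b : ole a b -> olt a (osucc b).
Proof. intros H; exists tt; exact H. Qed.

Lemma olt_osucc_inv a b : olt a (osucc b) -> ole a b.
Proof. intros [_ H]; exact H. Qed.

Lemma olt_osucc_diag a : olt a (osucc a).
Proof. apply ole_olt_osucc, ole_refl. Qed.

Lemma olt_ole a b : olt a b -> ole a b.
Proof.
  revert b; induction a as [X f IH]; intros [Y g] [j Hj] i; exists j.
  apply IH; destruct (g j) as [Z h]; exact (Hj i).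
Qed.

Lemma olt_wf : well_founded olt.
Proof.
  (* Generalizing to all [b] below or equal to [a] lets structural induction on the tree of [a]
     reach everything under one of its branches. *)
  assert (H : forall a b, ole b a -> Acc olt b).
  { induction a as [X f IH]; intros b Hb; constructor; intros c Hc.
    destruct (olt_ole_trans _ _ _ Hc Hb) as [j Hj]; exact (IH j c Hj). }
  intros a; exact (H a a (ole_refl a)).
Qed.

Lemma olt_irrefl a : ~ olt a a.
Proof.
  induction a as [a IH] using (well_founded_induction olt_wf).
  intros H; exact (IH a H H).
Qed.

(** The induction hypothesis for a branch [f i] is used twice: against the whole of [b], and against
    each branch [g j]. If no [g j] bounds [f i], then all of them lie strictly below it, so [b] is
    at most [f i]. *)
Lemma ole_or_olt a b : ole a b \/ olt b a.
Proof.
  revert b; induction a as [X f IH]; intros [Y g].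
  destruct (classic (exists i, ole (osup Y g) (f i))) as [H | H]; [right; exact H |].
  left; intros i; destruct (IH i (osup Y g)) as [Hi | Hi].
  - destruct (classic (exists j, ole (f i) (g j))) as [Hj | Hj]; [exact Hj | exfalso].
    apply H; exists i; intros j.
    assert (Hlt : olt (g j) (f i)).
    { destruct (IH i (g j)) as [K | K]; [destruct Hj; exists j |]; exact K. }
    destruct (f i); exact Hlt.
  - exfalso; apply H; exists i; apply olt_ole; exact Hi.
Qed.

Lemma ole_ozero a : ole ozero a.
Proof. intros []. Qed.

Lemma ole_max a b : exists c, ole a c /\ ole b c /\ (c = a \/ c = b).
Proof.
  destruct (ole_or_olt a b) as [H | H].
  - exists b; auto using ole_refl.
  - exists a; auto using ole_refl, olt_ole.
Qed.

Lemma olt_ozero a b : olt a b -> olt ozero b.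
Proof. apply ole_olt_trans, ole_ozero. Qed.

Lemma limit_or_osucc a :
  (forall b, olt b a -> olt (osucc b) a) \/ exists b, oeq a (osucc b).
Proof.
  destruct (classic (exists b, olt b a /\ ~ olt (osucc b) a)) as [[b [Hb Hs]] | H].
  - right; exists b; split; [| apply olt_osucc_ole; exact Hb].
    destruct (ole_or_olt a (osucc b)); [assumption | contradiction].
  - left; intros b Hb; apply NNPP; intros Hs; apply H; exists b; auto.
Qed.

(** The pattern of the truth clause: [P] holds from some stage below [a] up to [a]. Nothing has this
    property at [ozero], and at a successor only the predecessor matters. *)
Definition tail (a : Ord) (P : Ord -> Prop) : Prop :=
  exists g, olt g a /\ forall d, ole g d -> olt d a -> P d.

Lemma tail_impl a (P Q : Ord -> Prop) :
  (forall d, olt d a -> P d -> Q d) -> tail a P -> tail a Q.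
Proof. intros H [g [Hg Hd]]; exists g; split; auto. Qed.

Lemma tail_and a (P Q : Ord -> Prop) :
  tail a P -> tail a Q -> tail a (fun d => P d /\ Q d).
Proof.
  intros [g [Hg HP]] [h [Hh HQ]].
  destruct (ole_max g h) as [m [H1 [H2 H3]]].
  exists m; split; [destruct H3; subst; assumption |].
  intros d Hm Hd; split; [apply HP | apply HQ]; eauto using ole_trans.
Qed.

Lemma tail_const a (P : Prop) : olt ozero a -> (tail a (fun _ => P) <-> P).
Proof.
  intros H; split.
  - intros [g [Hg HP]]; exact (HP g (ole_refl g) Hg).
  - intros HP; exists ozero; auto.
Qed.

Lemma tail_ge a g : olt g a -> tail a (ole g).
Proof. intros H; exists g; auto. Qed.

Lemma tail_osucc a (P : Ord -> Prop) : tail (osucc a) P -> P a.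
Proof.
  intros [g [Hg HP]]; apply HP; [apply olt_osucc_inv; exact Hg | apply olt_osucc_diag].
Qed.

Definition eventually (P : Ord -> Prop) : Prop := exists r, forall b, ole r b -> P b.

Lemma eventually_impl (P Q : Ord -> Prop) :
  (forall b, P b -> Q b) -> eventually P -> eventually Q.
Proof. intros H [r Hr]; exists r; auto. Qed.

Lemma eventually_and (P Q : Ord -> Prop) :
  eventually P -> eventually Q -> eventually (fun b => P b /\ Q b).
Proof.
  intros [r Hr] [s Hs]; destruct (ole_max r s) as [m [H1 [H2 _]]].
  exists m; intros b Hb; split; eauto using ole_trans.
Qed.

Lemma eventually_gt g : eventually (olt g).
Proof. exists (osucc g); intros b; apply osucc_ole_olt. Qed.

(** * Syntax *)

Scheme term_form_ind := Induction for term Sort Prop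
  with form_term_ind := Induction for form Sort Prop.

Lemma subst_t_notfree x b t : ~ free_t x t -> subst_t x b t = t.
Proof.
  apply (term_form_ind (fun t => ~ free_t x t -> subst_t x b t = t)
                       (fun A => ~ free_f x A -> subst_f x b A = A));
    simpl; intros; auto.
  - destruct (Nat.eqb_spec v x); [contradiction | reflexivity].
  - destruct (Nat.eqb_spec v x); [reflexivity | f_equal; auto].
  - f_equal; auto.
  - f_equal; auto.
  - f_equal; auto.
  - f_equal; auto.
  - destruct (Nat.eqb_spec v x); [reflexivity | f_equal; auto].
Qed.

Lemma subst_t_closed x b t : closed t -> subst_t x b t = t.
Proof. intros H; apply subst_t_notfree, H. Qed.

Lemma sentence_mem s t : closed s -> closed t -> sentence (mem s t).
Proof. intros Hs Ht x [H | H]; [exact (Hs x H) | exact (Ht x H)]. Qed.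

Lemma sentence_down A B : sentence A -> sentence B -> sentence (down A B).
Proof. intros HA HB x [H | H]; [exact (HA x H) | exact (HB x H)]. Qed.

Lemma sentence_neg A : sentence A -> sentence (negF A).
Proof. intros; apply sentence_down; auto. Qed.

Lemma sentence_or A B : sentence A -> sentence B -> sentence (orF A B).
Proof. intros; apply sentence_neg, sentence_down; auto. Qed.

Lemma sentence_imp A B : sentence A -> sentence B -> sentence (impF A B).
Proof. intros; apply sentence_or; auto using sentence_neg. Qed.

Lemma sentence_iff A B : sentence A -> sentence B -> sentence (iffF A B).
Proof. intros; apply sentence_down; auto using sentence_neg, sentence_imp. Qed.

Lemma sentence_Tr A : sentence A -> sentence (Tr A).
Proof. intros HA x [H | []]; exact (HA x H). Qed.

Lemma sentence_all v A : (forall x, free_f x A -> x = v) -> sentence (all v A).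
Proof. intros H x [Hv Hx]; apply Hv; symmetry; auto. Qed.

Lemma closed_abs v A : (forall x, free_f x A -> x = v) -> closed (abs v A).
Proof. intros H x [Hv Hx]; apply Hv; symmetry; auto. Qed.

Ltac solve_free :=
  intros; simpl in *;
  repeat match goal with
  | H : _ \/ _ |- _ => destruct H
  | H : _ /\ _ |- _ => destruct H
  | H : False |- _ => destruct H
  | Hc : closed ?t, H : free_t ?x ?t |- _ => destruct (Hc x H)
  end; auto; try congruence.

(** The bound variable of [eqF] is made a parameter, so that identities can occur inside abstracts
    with a bound variable chosen in advance. For closed terms the choice does not affect truth at a
    stage. *)
Definition eq_at (u : nat) (s t : term) : form :=
  all u (impF (mem s (var u)) (mem t (var u))).

Lemma sentence_eq_at u s t : closed s -> closed t -> sentence (eq_at u s t).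
Proof. intros; apply sentence_all; solve_free. Qed.

Definition coext_at (u : nat) (s t : term) : form :=
  all u (iffF (mem (var u) s) (mem (var u) t)).

Lemma sentence_coext_at u s t : closed s -> closed t -> sentence (coext_at u s t).
Proof. intros; apply sentence_all; solve_free. Qed.

Lemma sentence_orthodoxF b : closed b -> sentence (orthodoxF b).
Proof. intros; apply sentence_all; solve_free. Qed.

#[local] Hint Resolve sentence_mem sentence_down sentence_neg sentence_or
  sentence_imp sentence_iff sentence_Tr sentence_eq_at
  sentence_coext_at sentence_orthodoxF : core.

(** * Truth of compound sentences at a stage *)

Section Semantics.
Variable sat : Ord -> nat -> form -> Prop.
Hypothesis sat_lib : librationist sat.

Lemma sat_down b n A B : sentence A -> sentence B ->
  (sat b n (down A B) <-> ~ sat b n A /\ ~ sat b n B).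
Proof. intros; apply (proj1 (sat_full _ sat_lib b n)); auto. Qed.

Lemma sat_neg b n A : sentence A -> (sat b n (negF A) <-> ~ sat b n A).
Proof. intros; unfold negF; rewrite sat_down by auto; tauto. Qed.

Lemma sat_or b n A B : sentence A -> sentence B ->
  (sat b n (orF A B) <-> sat b n A \/ sat b n B).
Proof. intros; unfold orF; rewrite sat_neg, sat_down by auto; tauto. Qed.

Lemma sat_imp b n A B : sentence A -> sentence B ->
  (sat b n (impF A B) <-> (sat b n A -> sat b n B)).
Proof. intros; unfold impF; rewrite sat_or, sat_neg by auto; tauto. Qed.

Lemma sat_iff b n A B : sentence A -> sentence B ->
  (sat b n (iffF A B) <-> (sat b n A <-> sat b n B)).
Proof.
  intros; unfold iffF, andF.
  rewrite sat_down, !sat_neg, !sat_imp by auto 8; tauto.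
Qed.

Lemma sat_all b n v A : sentence (all v A) ->
  (sat b n (all v A) <-> forall c, closed c -> sat b n (subst_f v c A)).
Proof. apply (proj2 (sat_full _ sat_lib b n)). Qed.

Lemma sat_oeq_iff a b n A : ole a b -> ole b a -> (sat a n A <-> sat b n A).
Proof.
  intros H1 H2; split; apply (sat_oeq _ sat_lib); split; assumption.
Qed.

Lemma sat_truth b n A : olt ozero b -> sentence A ->
  (sat b n (Tr A) <-> tail b (fun d => sat d n A)).
Proof. apply (sat_Tr _ sat_lib). Qed.

Lemma sat_truth_osucc b n A : sentence A -> (sat (osucc b) n (Tr A) <-> sat b n A).
Proof.
  intros HA; rewrite sat_truth by (auto; apply ole_olt_osucc, ole_ozero); split.
  - apply tail_osucc.
  - intros H; exists b; split; [apply olt_osucc_diag |].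
    intros d H1 H2; apply olt_osucc_inv in H2.
    apply (sat_oeq_iff b d n A H1 H2); exact H.
Qed.

Lemma sat_mem_abs b n c x A : olt ozero b -> closed c -> closed (abs x A) ->
  sentence (subst_f x c A) ->
  (sat b n (mem c (abs x A)) <-> tail b (fun d => sat d n (subst_f x c A))).
Proof.
  intros; rewrite (sat_abs _ sat_lib) by assumption; apply sat_truth; assumption.
Qed.

Lemma sat_eq_at b n u s t : closed s -> closed t ->
  (sat b n (eq_at u s t) <->
   forall c, closed c -> sat b n (mem s c) -> sat b n (mem t c)).
Proof.
  intros Hs Ht; unfold eq_at; rewrite sat_all by (apply sentence_eq_at; auto).
  assert (E : forall c, subst_f u c (impF (mem s (var u)) (mem t (var u))) = impF (mem s c) (mem t c)).
  { intros c; simpl; rewrite Nat.eqb_refl, !subst_t_closed by auto; reflexivity. }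
  split; intros H c Hc; specialize (H c Hc); [rewrite E in H | rewrite E];
    apply (sat_imp b n (mem s c) (mem t c)); auto.
Qed.

Lemma sat_coext_at b n u s t : closed s -> closed t ->
  (sat b n (coext_at u s t) <->
   forall c, closed c -> (sat b n (mem c s) <-> sat b n (mem c t))).
Proof.
  intros Hs Ht; unfold coext_at; rewrite sat_all by (apply sentence_coext_at; auto).
  assert (E : forall c, subst_f u c (iffF (mem (var u) s) (mem (var u) t)) = iffF (mem c s) (mem c t)).
  { intros c; simpl; rewrite Nat.eqb_refl, !subst_t_closed by auto; reflexivity. }
  split; intros H c Hc; specialize (H c Hc); [rewrite E in H | rewrite E];
    apply (sat_iff b n (mem c s) (mem c t)); auto.
Qed.

Lemma sat_orthodoxF b n s : closed s ->
  (sat b n (orthodoxF s) <->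
   forall c, closed c -> sat b n (Tr (mem c s)) \/ sat b n (Tr (negF (mem c s)))).
Proof.
  intros Hs; unfold orthodoxF; rewrite sat_all by (apply sentence_orthodoxF; auto).
  set (x := fresh_t s).
  assert (E : forall c, subst_f x c (orF (Tr (mem (var x) s)) (Tr (negF (mem (var x) s))))
      = orF (Tr (mem c s)) (Tr (negF (mem c s)))).
  { intros c; simpl; rewrite Nat.eqb_refl, !subst_t_closed by auto; reflexivity. }
  split; intros H c Hc; specialize (H c Hc); [rewrite E in H | rewrite E];
    apply (sat_or b n (Tr (mem c s)) (Tr (negF (mem c s)))); auto.
Qed.

(** * Identity *)

(** Leibniz's law is applied to [U], the set of all [x] with [s = x]. Reflexivity at all earlier
    stages puts [s] into [U]; then [t] is in [U], which says that [s = t] on a tail. *)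
Lemma eq_at_tail b n u s t : olt ozero b -> closed s -> closed t ->
  sat b n (eq_at u s t) -> tail b (fun d => sat d n (eq_at u s t)).
Proof.
  intros Hb Hs Ht H; rewrite sat_eq_at in H by auto.
  (* The abstracted variable [S u] is chosen to differ from the quantified [u]. *)
  set (U := abs (S u) (all u (impF (mem s (var u)) (mem (var (S u)) (var u))))).
  assert (HU : closed U) by (apply closed_abs; solve_free).
  assert (HS : forall c, closed c -> subst_f (S u) c
      (all u (impF (mem s (var u)) (mem (var (S u)) (var u)))) = eq_at u s c).
  { intros c Hc; unfold eq_at; cbn -[Nat.eqb].
    assert (E : Nat.eqb u (S u) = false) by (apply Nat.eqb_neq, Nat.neq_succ_diag_r).
    rewrite E, Nat.eqb_refl, !subst_t_closed by auto; reflexivity. }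
  specialize (H U HU); unfold U in H; rewrite !sat_mem_abs, !HS in H by
    (auto; rewrite HS; auto).
  apply H; apply (tail_impl b (fun _ => True)); [| apply tail_const; auto].
  intros d _ _; apply sat_eq_at; auto.
Qed.

(** The same argument, with [U] the set of all [x] coextensive with [s]. *)
Lemma eq_at_tail_coext b n u s t : olt ozero b -> closed s -> closed t ->
  sat b n (eq_at u s t) -> tail b (fun d => sat d n (coext_at u s t)).
Proof.
  intros Hb Hs Ht H; rewrite sat_eq_at in H by auto.
  set (U := abs (S u) (all u (iffF (mem (var u) s) (mem (var u) (var (S u)))))).
  assert (HU : closed U) by (apply closed_abs; solve_free).
  assert (HS : forall c, closed c -> subst_f (S u) c
      (all u (iffF (mem (var u) s) (mem (var u) (var (S u))))) = coext_at u s c).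
  { intros c Hc; unfold coext_at; cbn -[Nat.eqb].
    assert (E : Nat.eqb u (S u) = false) by (apply Nat.eqb_neq, Nat.neq_succ_diag_r).
    rewrite E, Nat.eqb_refl, !subst_t_closed by auto; reflexivity. }
  specialize (H U HU); unfold U in H; rewrite !sat_mem_abs, !HS in H by
    (auto; rewrite HS; auto).
  apply H; apply (tail_impl b (fun _ => True)); [| apply tail_const; auto].
  intros d _ _; apply sat_coext_at; tauto.
Qed.

Lemma eq_at_downward b n u s t : closed s -> closed t ->
  sat b n (eq_at u s t) -> forall g, ole g b -> sat g n (eq_at u s t).
Proof.
  intros Hs Ht; induction b as [b IH] using (well_founded_induction olt_wf).
  intros H g Hg; destruct (ole_or_olt b g) as [K | K].
  - apply (sat_oeq_iff g b); auto.
  (* The tail starts at some [h] below [b]. Stages from [h] on are covered by it, and earlier ones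
     by induction at [h], where the identity holds too. *)
  - destruct (eq_at_tail b n u s t) as [h [Hh HE]]; eauto using olt_ozero.
    destruct (ole_or_olt h g) as [L | L]; [auto |].
    apply (IH h Hh); [apply HE; auto using ole_refl | apply olt_ole; exact L].
Qed.

(** The identity is first brought down to [osucc g], all of whose tails contain [g]; this is why [g]
    must be strictly below [b]. *)
Lemma eq_at_coext_below b n u s t : closed s -> closed t ->
  sat b n (eq_at u s t) -> forall g, olt g b ->
  forall c, closed c -> (sat g n (mem c s) <-> sat g n (mem c t)).
Proof.
  intros Hs Ht H g Hg; apply (sat_coext_at g n u); auto.
  apply (tail_osucc g (fun d => sat d n (coext_at u s t))).
  apply eq_at_tail_coext; auto; [apply ole_olt_osucc, ole_ozero |].
  apply (eq_at_downward b); auto; apply olt_osucc_ole; exact Hg.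
Qed.

(** * The diagonal set *)

Definition falsum : form := down (mem cT cT) (negF (mem cT cT)).

(* Copies [a] if [t] is not a member of itself, and its complement otherwise. *)
Definition twist (a t : term) : term :=
  abs 1 (iffF (mem (var 1) a) (negF (mem t t))).

(** Both directions are listed because the Leibniz formula is a one-way implication. Variable 2 is
    bound here, 1 in [twist] and 0 in [diag], so the three never clash. *)
Definition some_eq (L : list term) (s : term) : form :=
  fold_right (fun p D => orF (orF (eq_at 2 s p) (eq_at 2 p s)) D) falsum L.

Definition diag (a : term) (L : list term) : term :=
  abs 0 (some_eq L (twist a (var 0))).

Definition next (a : term) (L : list term) : term := twist a (diag a L).

Lemma closed_twist a t : closed a -> closed t -> closed (twist a t).
Proof. intros; apply closed_abs; solve_free. Qed.

Lemma closed_diag a L : closed a -> Forall closed L -> closed (diag a L).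
Proof.
  intros Ha HL; apply closed_abs; intros x.
  induction HL as [| p L Hp HL IH]; solve_free.
Qed.

Lemma sentence_some_eq L s : closed s -> Forall closed L -> sentence (some_eq L s).
Proof.
  intros Hs HL; induction HL as [| p L Hp HL IH]; simpl.
  - intros x Hx; solve_free.
  - auto 8.
Qed.

Lemma subst_diag a L c : closed a -> Forall closed L ->
  subst_f 0 c (some_eq L (twist a (var 0))) = some_eq L (twist a c).
Proof.
  intros Ha HL; induction HL as [| p L Hp HL IH]; [reflexivity |].
  simpl; rewrite IH, !subst_t_closed by auto; reflexivity.
Qed.

Lemma sat_some_eq b n L s : closed s -> Forall closed L ->
  (sat b n (some_eq L s) <->
   exists p, In p L /\ (sat b n (eq_at 2 s p) \/ sat b n (eq_at 2 p s))).
Proof.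
  intros Hs HL; induction HL as [| p L Hp HL IH]; simpl.
  - assert (sentence (mem cT cT)) by (intros x Hx; solve_free).
    unfold falsum; rewrite sat_down, sat_neg by auto.
    firstorder.
  - assert (sentence (some_eq L s)) by (apply sentence_some_eq; auto).
    rewrite !sat_or by auto 8; rewrite IH; split.
    + intros [K | [q [Hq K]]]; [exists p | exists q]; auto.
    + intros [q [[<- | Hq] K]]; [left; exact K | right; exists q; auto].
Qed.

Lemma sat_mem_diag b n a L c : olt ozero b -> closed a -> closed c ->
  Forall closed L ->
  (sat b n (mem c (diag a L)) <-> tail b (fun d => sat d n (some_eq L (twist a c)))).
Proof.
  intros Hb Ha Hc HL; rewrite <- (subst_diag a L c) by auto.
  apply sat_mem_abs; auto; [apply closed_diag; auto |].
  rewrite subst_diag by auto; apply sentence_some_eq; auto; apply closed_twist; auto.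
Qed.

Lemma sat_mem_twist b n a t c : olt ozero b -> closed a -> closed t -> closed c ->
  (sat b n (mem c (twist a t)) <->
   tail b (fun d => sat d n (mem c a) <-> ~ sat d n (mem t t))).
Proof.
  intros Hb Ha Ht Hc; unfold twist.
  assert (E : subst_f 1 c (iffF (mem (var 1) a) (negF (mem t t)))
              = iffF (mem c a) (negF (mem t t))).
  { simpl; rewrite !subst_t_closed by auto; reflexivity. }
  rewrite sat_mem_abs; auto;
    [| apply closed_twist; auto | rewrite E; auto 8].
  rewrite E; split; apply tail_impl; intros d _;
    rewrite sat_iff, sat_neg by auto; auto.
Qed.

(** The limiting values [V] are a parameter, so terms that settle to the same [V] are eventually
    coextensive. They may depend on the model [n], but the stage from which they hold may not. *)
Definition settles (V : nat -> term -> Prop) (b : term) : Prop :=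
  closed b /\
  eventually (fun d => forall n c, closed c -> (sat d n (mem c b) <-> V n c)).

Lemma settles_forall V L : Forall (settles V) L ->
  eventually (fun d => forall p, In p L ->
    forall n c, closed c -> (sat d n (mem c p) <-> V n c)).
Proof.
  induction 1 as [| p L [_ Hp] _ IH].
  - exists ozero; intros b _ p [].
  - destruct (eventually_and _ _ Hp IH) as [r Hr]; exists r.
    intros b Hb q [<- | Hq]; [exact (proj1 (Hr b Hb)) | exact (proj2 (Hr b Hb) q Hq)].
Qed.

Lemma settles_closed V L : Forall (settles V) L -> Forall closed L.
Proof. apply Forall_impl; intros p [H _]; exact H. Qed.

(* An identity [next a L = p] at a late stage would hold at all earlier ones,
   making [diag a L] a member of itself throughout and hence [next a L]
   coextensive with the complement of [a] rather than with [p]. *)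
Lemma next_differs V a L : settles V a -> Forall (settles V) L ->
  eventually (fun b => forall n, ~ sat b n (some_eq L (next a L))).
Proof.
  intros [Ha HaV] HL; pose proof (settles_closed _ _ HL) as HLc.
  pose proof (closed_diag a L Ha HLc) as Hr.
  assert (Hb : closed (next a L)) by (apply closed_twist; auto).
  destruct (eventually_and _ _ (eventually_gt ozero)
             (eventually_and _ _ HaV (settles_forall _ _ HL))) as [r Hev].
  (* Self-membership of [diag a L] is evaluated at [r], the members of [next a L] and [p] are
     compared at [osucc r], and the identity must sit strictly above that. *)
  exists (osucc (osucc r)); intros b Hrb n Hsat.
  rewrite sat_some_eq in Hsat by auto; destruct Hsat as [p [Hp Heq]].
  assert (Hpc : closed p) by (apply (proj1 (Forall_forall _ _) HLc); exact Hp).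
  pose proof (osucc_ole_olt _ _ Hrb) as Hlt.
  assert (Hrr : sat r n (mem (diag a L) (diag a L))).
  { assert (H0 : olt ozero r) by (apply Hev, ole_refl).
    apply sat_mem_diag; auto; exists ozero; split; [exact H0 |].
    intros d _ Hd; apply sat_some_eq; auto; exists p; split; [exact Hp |].
    assert (Hdb : ole d b).
    { apply olt_ole, (olt_ole_trans _ r); auto.
      apply olt_ole, (olt_ole_trans _ (osucc r)); [apply olt_osucc_diag |].
      apply olt_ole; exact Hlt. }
    destruct Heq as [Heq | Heq]; [left | right]; apply (eq_at_downward b); auto. }
  (* Any closed term would do as test member; [cT] is one. *)
  assert (Hco : sat (osucc r) n (mem cT (next a L)) <-> sat (osucc r) n (mem cT p)).
  { assert (closed cT) by (intros x []).
    destruct Heq as [Heq | Heq].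
    - apply (eq_at_coext_below b n 2); auto.
    - symmetry; apply (eq_at_coext_below b n 2); auto. }
  assert (HcT : closed cT) by (intros x []).
  assert (Hs : ole r (osucc r)) by apply olt_ole, olt_osucc_diag.
  unfold next in Hco; rewrite sat_mem_twist in Hco by
    (auto; apply ole_olt_osucc, ole_ozero).
  rewrite (proj2 (proj2 (Hev _ Hs)) p Hp n cT HcT) in Hco.
  (* At [osucc r] only stage [r] counts, and there [diag a L] is in itself, so the biconditional
     negates membership in [a]. *)
  assert (Ht : tail (osucc r) (fun d => sat d n (mem cT a) <->
                 ~ sat d n (mem (diag a L) (diag a L))) <-> ~ V n cT).
  { pose proof (proj1 (proj2 (Hev _ (ole_refl r))) n cT HcT) as HV.
    split.
    - intros K; apply tail_osucc in K; tauto.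
    - intros K; exists r; split; [apply olt_osucc_diag |].
      intros d H1 H2; apply olt_osucc_inv in H2.
      rewrite !(sat_oeq_iff d r) by auto; tauto. }
  tauto.
Qed.

Lemma next_settles V a L : settles V a -> Forall (settles V) L -> settles V (next a L).
Proof.
  intros Hsa HL; pose proof (next_differs V a L Hsa HL) as Hd.
  destruct Hsa as [Ha HaV]; pose proof (settles_closed _ _ HL) as HLc.
  pose proof (closed_diag a L Ha HLc) as Hr.
  split; [apply closed_twist; auto |].
  destruct Hd as [r Hd].
  (* Self-membership at [b] would need an identity of [next a L] with a member of [L] on a tail
     below [b], and such a tail contains stages from [r] on, where none holds. *)
  assert (Hself : forall b n, olt r b -> ~ sat b n (mem (diag a L) (diag a L))).
  { intros b n Hb; rewrite sat_mem_diag by eauto using olt_ozero.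
    intros H; apply (tail_const b False); [eauto using olt_ozero |].
    generalize (tail_and _ _ _ (tail_ge _ _ Hb) H); apply tail_impl.
    intros d _ [H1 H2]; exact (Hd d H1 n H2). }
  destruct HaV as [s Hs]; destruct (ole_max (osucc r) s) as [m [H1 [H2 _]]].
  exists (osucc m); intros b Hb n c Hc; apply osucc_ole_olt in Hb.
  unfold next; rewrite sat_mem_twist by eauto using olt_ozero.
  rewrite <- (tail_const b (V n c)) by eauto using olt_ozero.
  assert (E : forall d, ole m d -> (sat d n (mem c a) <-> V n c) /\
              ~ sat d n (mem (diag a L) (diag a L))).
  { intros d Hd'; split; [apply Hs; eauto using ole_trans |].
    apply Hself, osucc_ole_olt; eauto using ole_trans. }
  split; intros H; generalize (tail_and _ _ _ (tail_ge _ _ Hb) H); apply tail_impl;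
    intros d _ [K1 K2]; specialize (E d K1); tauto.
Qed.

Lemma next_neq V a L p : settles V a -> Forall (settles V) L -> In p L ->
  eventually (fun b => forall n u,
    ~ sat b n (eq_at u (next a L) p) /\ ~ sat b n (eq_at u p (next a L))).
Proof.
  intros Ha HL Hp; generalize (next_differs V a L Ha HL); apply eventually_impl.
  pose proof (settles_closed _ _ HL) as HLc.
  assert (Hb : closed (next a L)) by (apply (next_settles V); auto).
  assert (Hpc : closed p) by (apply (proj1 (Forall_forall _ _) HLc); exact Hp).
  intros b H n u; specialize (H n); rewrite sat_some_eq in H by auto.
  split; intros K; apply H; exists p; split; auto; [left | right];
    rewrite sat_eq_at in *; auto.
Qed.

(** * Iterating the construction *)

Fixpoint nexts (a : term) (n : nat) : list term :=
  match n with
  | 0 => nil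
  | S m => next a (nexts a m) :: nexts a m
  end.

Lemma nexts_settle V a n : settles V a -> Forall (settles V) (nexts a n).
Proof.
  intros Ha; induction n as [| n IH]; simpl; constructor; auto.
  apply next_settles; auto.
Qed.

Lemma In_nexts a i j : i < j -> In (next a (nexts a i)) (nexts a j).
Proof.
  intros H; induction H; simpl; auto.
Qed.

(** * Stabilization *)

(** The truth predicate is dropped by looking one stage up, where [Tr A] has the value of [A], and
    regained past [r], where a tail of stages verifies [A]. *)
Lemma IN_eventually A : sentence A ->
  (IN sat A <-> eventually (fun b => forall n, sat b n A)).
Proof.
  intros HA; split; intros [r Hr].
  - exists r; intros b Hb n; apply sat_truth_osucc; [exact HA |].
    apply Hr, (ole_trans _ b); [exact Hb | apply olt_ole, olt_osucc_diag].
  - exists (osucc r); intros b Hb n; apply osucc_ole_olt in Hb.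
    apply sat_truth; eauto using olt_ozero; exists r; auto.
Qed.

Lemma INat_sat r A : sentence A -> INat sat r A ->
  forall b n, ole r b -> sat b n A.
Proof.
  intros HA H b n Hb; apply sat_truth_osucc; [exact HA |].
  apply H, (ole_trans _ b); [exact Hb | apply olt_ole, olt_osucc_diag].
Qed.

(** By induction on [b]: above [r], the value of [A] at [b] is that of [Tr A], which is read off a
    tail of earlier stages, and those beyond [r] already agree with [r]. *)
Lemma sat_constant n A r b : sentence A -> ole r b ->
  (forall d, ole r d -> ole d b -> (sat d n A <-> sat d n (Tr A))) ->
  (sat b n A <-> sat r n A).
Proof.
  intros HA; induction b as [b IH] using (well_founded_induction olt_wf).
  intros Hrb H; destruct (ole_or_olt b r) as [K | K].
  - apply sat_oeq_iff; auto.
  - rewrite H by auto using ole_refl; rewrite sat_truth by eauto using olt_ozero.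
    rewrite <- (tail_const b (sat r n A)) by eauto using olt_ozero.
    assert (E : forall d, olt d b -> ole r d -> (sat d n A <-> sat r n A)).
    { intros d Hd Hrd; apply IH; auto.
      intros e He1 He2; apply H; auto.
      apply (ole_trans _ d); auto using olt_ole. }
    split; intros T; generalize (tail_and _ _ _ (tail_ge _ _ K) T); apply tail_impl;
      intros d Hd [K1 K2]; apply (E d Hd K1); exact K2.
Qed.

(** * Passing between eventual truth and [varpi] *)

Section Varpi.
Variable varpi : Ord.
Hypothesis varpi_def : is_varpi sat varpi.
Hypothesis varpi_gt1 : olt (osucc ozero) varpi.

(* If [varpi] were the successor of [b], applying its stabilization of [Tr A]
   one stage lower would show that [b] stabilizes [A] already. *)
Lemma varpi_limit b : olt b varpi -> olt (osucc b) varpi.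
Proof.
  destruct varpi_def as [Hst Hmin].
  destruct (limit_or_osucc varpi) as [H | [p [Hp1 Hp2]]]; [apply H | exfalso].
  assert (Hp : stabilizes_all sat p).
  { intros A HA; destruct (Hst (Tr A) (sentence_Tr _ HA)) as [H1 H2]; split.
    - intros HIN c Hc n.
      assert (HT : IN sat (Tr A)).
      (* Being in [IN] for [A] already says that [Tr A] holds from some stage on in every model. *)
      { apply IN_eventually; auto; destruct HIN as [r Hr]; exists r; exact Hr. }
      apply sat_truth_osucc; auto; apply (H1 HT), (ole_trans _ (osucc p)); auto.
      apply olt_osucc_ole, ole_olt_osucc; exact Hc.
    - intros Hm; assert (HT : IN sat (Tr A)).
      { apply H2; intros n; apply (sat_oeq_iff varpi (osucc p)); auto.
        apply sat_truth_osucc; auto. }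
      apply (proj1 (IN_eventually (Tr A) (sentence_Tr _ HA))) in HT; exact HT. }
  apply (olt_irrefl p), osucc_ole_olt, (ole_trans _ varpi); auto.
Qed.

Lemma varpi_pos : olt ozero varpi.
Proof. exact (olt_ozero _ _ varpi_gt1). Qed.

Lemma eventually_forcesM A : sentence A ->
  eventually (fun b => forall n, sat b n A) -> forcesM sat varpi A.
Proof.
  intros HA H; apply (proj2 (IN_eventually A HA)) in H.
  apply (proj1 (proj1 varpi_def A HA) H), ole_refl.
Qed.

(** Whether [c] is in [a] may vary with the model, so neither [A] nor its negation need be true in
    all of them. The sentence [B] is true in all models on tails below [varpi], hence stabilization
    applies to [B] and makes it hold from [varpi] on. *)
Lemma orthodox_settles a : orthodox sat varpi a ->
  settles (fun n c => sat varpi n (mem c a)) a.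
Proof.
  intros [Ha HO]; split; [exact Ha |].
  exists varpi; intros b Hb n c Hc.
  set (A := mem c a); assert (HA : sentence A) by (unfold A; auto).
  set (B := iffF A (Tr A)).
  assert (HB : sentence B) by (unfold B; auto 8).
  (* Where [A] has been constant since a stage [g] strictly below [d], its value at [d] agrees with
     that of [Tr A]. *)
  assert (Hlater : forall m g d, olt g d -> olt d varpi ->
      (forall e, ole g e -> olt e varpi -> sat e m A) \/
      (forall e, ole g e -> olt e varpi -> ~ sat e m A) -> sat d m B).
  { intros m g d Hg Hd Hconst; unfold B; rewrite sat_iff, sat_truth by
      eauto using olt_ozero.
    assert (E : forall e, ole g e -> olt e varpi -> (sat e m A <-> sat d m A)).
    { assert (ole g d) by auto using olt_ole; intros e He1 He2.
      destruct Hconst as [K | K];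
        pose proof (K e He1 He2); pose proof (K d ltac:(assumption) Hd); tauto. }
    rewrite <- (tail_const d (sat d m A)) by eauto using olt_ozero.
    split; intros T; generalize (tail_and _ _ _ (tail_ge _ _ Hg) T); apply tail_impl;
      intros e He [K1 K2]; apply (E e); auto;
      apply (olt_ole_trans _ d); auto using olt_ole. }
  assert (Hm : models sat varpi (Tr B)).
  { intros m; apply sat_truth; auto using varpi_pos.
    pose proof (proj1 (sat_orthodoxF varpi m a Ha) (HO m) c Hc) as D; fold A in D.
    rewrite !sat_truth in D by auto using varpi_pos.
    destruct D as [[g [Hg K]] | [g [Hg K]]];
      (* One stage beyond [g] is needed, since [Tr A] at [g] itself looks at stages before [g]. The
         limit property keeps [osucc g] below [varpi]. *)
      (exists (osucc g); split; [apply varpi_limit; exact Hg |]);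
      intros d Hd1 Hd2; apply (Hlater m g d); auto; try (apply osucc_ole_olt; exact Hd1).
    right; intros e He1 He2; apply sat_neg; auto. }
  apply sat_constant; auto; intros d Hd _.
  apply (sat_iff d n A (Tr A)); auto.
  destruct (proj1 varpi_def B HB) as [H1 H2].
  apply (INat_sat varpi B HB (H1 (H2 Hm))); exact Hd.
Qed.

(** The stage from which [b] settles may exceed [varpi]. The eventually true sentence [A <-> Tr A]
    carries the information back: it is true on a tail below [varpi], so [A] is constant there. *)
Lemma settles_orthodox V b : settles V b -> orthodox sat varpi b.
Proof.
  intros [Hb HV]; split; [exact Hb |]; intros n.
  apply sat_orthodoxF; auto; intros c Hc.
  set (A := mem c b); assert (HA : sentence A) by (unfold A; auto).
  assert (HF : forcesM sat varpi (iffF A (Tr A))).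
  { apply eventually_forcesM; [auto 8 |].
    destruct HV as [r Hr]; exists (osucc r); intros d Hd m; apply osucc_ole_olt in Hd.
    rewrite sat_iff, sat_truth by eauto using olt_ozero.
    unfold A; rewrite Hr by auto using olt_ole.
    rewrite <- (tail_const d (V m c)) by eauto using olt_ozero.
    split; intros T; generalize (tail_and _ _ _ (tail_ge _ _ Hd) T); apply tail_impl;
      intros e He [K1 K2]; apply (Hr e K1 m c Hc); exact K2. }
  specialize (HF n); rewrite sat_truth in HF by
    auto 8 using varpi_pos.
  destruct HF as [g [Hg HF]].
  assert (E : forall d, ole g d -> olt d varpi -> (sat d n A <-> sat g n A)).
  { intros d Hd1 Hd2; apply sat_constant; auto; intros e He1 He2.
    apply (sat_iff e n A (Tr A)); auto; apply HF; auto.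
    apply (ole_olt_trans _ d); auto. }
  rewrite !sat_truth by auto using varpi_pos.
  destruct (classic (sat g n A)) as [K | K]; [left | right];
    exists g; split; auto; intros d Hd1 Hd2.
  - apply E; auto.
  - apply sat_neg; auto; rewrite E; auto.
Qed.

End Varpi.
End Semantics.

(* [varpi_gt1] excludes only the starting sequences for which stage 0 or stage 1
   already stabilizes every sentence; there the claim can fail. *)
Theorem theorem19p0p1
  (sat : Ord -> nat -> form -> Prop) (sat_lib : librationist sat)
  (varpi : Ord) (varpi_def : is_varpi sat varpi)
  (varpi_gt1 : olt (osucc ozero) varpi)
  (a : term) (a_orth : orthodox sat varpi a) :
  exists b : nat -> term,
    (forall n, orthodox sat varpi (b n)) /\
    (forall i j, i <> j -> forcesM sat varpi (neqF (b i) (b j))) /\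
    (forall n, forcesM sat varpi (coextF (b n) a)).
Proof.
  pose proof (orthodox_settles sat sat_lib varpi varpi_def varpi_gt1 a a_orth) as Ha.
  (* The values of [a] at [varpi] are the common target for the whole sequence. *)
  set (V := fun n c => sat varpi n (mem c a)) in Ha.
  assert (HL : forall n, Forall (settles sat V) (nexts a n)).
  { intros n; apply nexts_settle; auto. }
  assert (Hb : forall n, settles sat V (next a (nexts a n))).
  { intros n; apply next_settles; auto. }
  exists (fun n => next a (nexts a n)); split; [| split].
  - intros n; apply (settles_orthodox sat sat_lib varpi varpi_def varpi_gt1 V); auto.
  - intros i j Hij.
    pose proof (proj1 (Hb i)) as Hi; pose proof (proj1 (Hb j)) as Hj.
    set (u := Nat.max (fresh_t (next a (nexts a i))) (fresh_t (next a (nexts a j)))).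
    assert (HS : sentence (eqF (next a (nexts a i)) (next a (nexts a j)))).
    { apply (sentence_eq_at u); auto. }
    apply eventually_forcesM; auto; [unfold neqF; auto |].
    assert (H : eventually (fun b => forall n,
        ~ sat b n (eq_at u (next a (nexts a i)) (next a (nexts a j))))).
    (* The term with the larger index was built to differ from the other, in both directions of
       identity, so either order of [i] and [j] is covered. *)
    { destruct (Nat.lt_gt_cases i j) as [[K | K] _]; [exact Hij | |];
        pose proof (next_neq sat sat_lib V a _ _ Ha (HL _) (In_nexts a _ _ K)) as H;
        revert H; apply eventually_impl; intros b H n; apply (H n u). }
    revert H; apply eventually_impl; intros b H n.
    apply (sat_neg sat sat_lib b n _ HS); exact (H n).
  - intros n; pose proof (proj1 (Hb n)) as Hn; pose proof (proj1 Ha) as Hac.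
    set (u := Nat.max (fresh_t (next a (nexts a n))) (fresh_t a)).
    apply eventually_forcesM; auto; [apply (sentence_coext_at u); auto |].
    generalize (eventually_and _ _ (proj2 (Hb n)) (proj2 Ha)); apply eventually_impl.
    intros b [H1 H2] m; apply (sat_coext_at sat sat_lib b m u); auto.
    intros c Hc; rewrite H1, H2 by auto; reflexivity.
Qed.
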